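(* Let $\sigma_1,\sigma_2>0$, $\rho\in\mathbb{R}$, and let $\psi_{11},\psi_{12},\psi_{22}:[0,\infty)\to\mathbb{R}$ be continuous functions, each a correlation function of a stationary isotropic univariate random field (in particular $\psi_{ij}(0)=1$); write $\psi_{21}=\psi_{12}$. Define $$C(r)=\begin{bmatrix}\sigma_1^2\psi_{11}(r)&\rho\sigma_1\sigma_2\psi_{12}(r)\\ \rho\sigma_1\sigma_2\psi_{12}(r)&\sigma_2^2\psi_{22}(r)\end{bmatrix},\qquad r\ge0.$$ (a) Suppose $\psi_{ij}$, $i,j=1,2$, are twice continuously differentiable on $(0,\infty)$ and: (i) $\psi_{ii}''(r)\ge0$ for all $r>0$, $i=1,2$; (ii) $\psi_{ij}(r)\to0$ and $r\psi_{ij}'(r)\to0$ as $r\to\infty$, $i,j=1,2$; (iii) $r\mapsto r\psi_{ij}''(r)$ is integrable on $(0,\infty)$, $i,j=1,2$; (iv) $\rho^2\le\inf_{r>0}\frac{\psi_{11}''(r)\psi_{22}''(r)}{(\psi_{12}''(r))^2}$. Then $C$ is positive definite in $\mathbb{R}$. (b) Suppose $\psi_{ij}$, $i,j=1,2$, are three times continuously differentiable on $(0,\infty)$ and: (i) $\psi_{ii}''(r)-r\psi_{ii}'''(r)\ge0$ for all $r>0$, $i=1,2$; (ii) $\psi_{ij}(r)\to0$, $r\psi_{ij}'(r)\to0$ and $r^2\psi_{ij}''(r)\to0$ as $r\to\infty$, $i,j=1,2$; (iii) $r\mapsto r\psi_{ij}''(r)-r^2\psi_{ij}'''(r)$ is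 integrable on $(0,\infty)$, $i,j=1,2$; (iv) $\rho^2\le\inf_{r>0}\frac{(\psi_{11}''(r)-r\psi_{11}'''(r))(\psi_{22}''(r)-r\psi_{22}'''(r))}{(\psi_{12}''(r)-r\psi_{12}'''(r))^2}$. Then $C$ is positive definite in $\mathbb{R}^3$.
   Context: A $2\times2$ matrix-valued function $C$ on $[0,\infty)$ is called positive definite in $\mathbb{R}^n$ if for every $p\in\mathbb{N}$, all $x_1,\dots,x_p\in\mathbb{R}^n$ and all $a_1,\dots,a_p\in\mathbb{R}^2$ one has $\sum_{i,j=1}^p a_i^T C(\|x_i-x_j\|)a_j\ge0$. In (a)(iv) the infimum is over those $r>0$ with $\psi_{12}''(r)\neq0$, and in (b)(iv) over those $r>0$ with $\psi_{12}''(r)-r\psi_{12}'''(r)\neq0$. *)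

(* Defs.v *)
From HB Require Import structures.
From mathcomp Require Import all_boot all_order all_algebra.
From mathcomp Require Import all_classical all_reals all_analysis.
Set Implicit Arguments. Unset Strict Implicit. Unset Printing Implicit Defensive.
Import Order.TTheory GRing.Theory Num.Theory.
Import numFieldNormedType.Exports.
Local Open Scope classical_set_scope.
Local Open Scope ring_scope.

Definition eucl_norm (R : realType) (n : nat) (v : 'rV[R]_n) : R :=
  Num.sqrt (\sum_(k < n) v 0 k ^+ 2).

Definition pos_def_in (R : realType) (n : nat) (C : R -> 'M[R]_2) : Prop :=
  forall (p : nat) (x : 'I_p -> 'rV[R]_n) (a : 'I_p -> 'rV[R]_2),
    0 <= \sum_(i < p) \sum_(j < p)
           (a i *m C (eucl_norm (x i - x j)) *m (a j)^T) 0 0.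

(* psi is the (isotropic) correlation function of a stationary isotropic
   univariate random field on R^n: continuous on [0,oo), psi 0 = 1, and
   x,y |-> psi(|x-y|) is positive definite on R^n. *)
Definition corr_fun_in (R : realType) (n : nat) (psi : R -> R) : Prop :=
  {within `[0, +oo[, continuous psi} /\ psi 0 = 1 /\
  forall (p : nat) (x : 'I_p -> 'rV[R]_n) (a : 'I_p -> R),
    0 <= \sum_(i < p) \sum_(j < p) a i * a j * psi (eucl_norm (x i - x j)).

Definition covC (R : realType) (s1 s2 rho : R) (psi11 psi12 psi22 : R -> R)
  (r : R) : 'M[R]_2 :=
  \matrix_(i < 2, j < 2)
    if i == j then (if val i == 0%N then s1 ^+ 2 * psi11 r else s2 ^+ 2 * psi22 r)
    else rho * s1 * s2 * psi12 r.

Definition Ck_pos (R : realType) (k : nat) (f : R -> R) : Prop :=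
  (forall (m : nat) (r : R), (m < k)%N -> 0 < r -> derivable (derive1n m f) r 1)
  /\ (forall r : R, 0 < r -> {for r, continuous (derive1n k f)}).

Definition integrable_pos (R : realType) (f : R -> R) : Prop :=
  (@lebesgue_measure R).-integrable `]0%R, +oo[%classic (fun r => (f r)%:E).

(* Main.v *)
(* A function f that vanishes at infinity is recovered from its derivatives as a
   mixture over T > 0 of compactly supported kernels,
     f r = int_r^oo (T - r) f''(T) dT                               on the line,
     f r = int_r^oo sph T r (f''(T) - T f'''(T)) / (3 T^2) dT       in space,
   where (T - r)_+ is the length of the overlap of two intervals of length T at
   distance r, and sph T r is, up to a constant factor, the volume of the overlap
   of two balls of diameter T at distance r.  Both kernels are positive definite,
   being Gram matrices of indicator functions, and the hypothesis on rho says that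
   the 2x2 matrix of the densities is positive semidefinite at every T, so that
   the Schur product is positive semidefinite for every T.

   No improper integral is needed: with P r T the integral truncated at T, in
   closed form, the quadratic form built from P is nondecreasing in T by the
   above and converges to the form of C.  For T smaller than all the positive
   distances only coincident points contribute, with the matrix of P 0 T, whose
   positivity is a convexity property. *)

Require Import Defs.
From HB Require Import structures.
From mathcomp Require Import all_boot all_order all_algebra.
From mathcomp Require Import all_classical all_reals all_analysis.
From mathcomp Require Import measurable_realfun ring lra.
Import Order.TTheory GRing.Theory Num.Theory.
Import numFieldNormedType.Exports.
Local Open Scope classical_set_scope.
Local Open Scope ring_scope.

(** * Affine substitution in one-dimensional Lebesgue integrals *)

Section affine_substitution.
Variable R : realType.
Local Notation mu := (@lebesgue_measure R).
Local Open Scope ereal_scope.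

Let affine (c d : R) : measurableTypeR R -> measurableTypeR R :=
  (fun x => c * x + d)%R.

Let measurable_affine (c d : R) : measurable_fun setT (affine c d).
Proof. by apply: measurable_funD => //; exact: measurable_funM. Qed.

Let image (c d : R) : {measure set (measurableTypeR R) -> \bar R} :=
  measure_function_pushforward__canonical__measure_function_Measure
    mu (measurable_affine c d).

(** The right-hand measure is determined by its values on half-open intervals, so it suffices to
    compare it there with the rescaled pushforward. For [c < 0] the preimage has its open and closed
    ends exchanged, but the same length. *)
Lemma lebesgue_measure_affine (c d : R) (A : set R) : c != 0%R ->
  measurable A ->
  `|c|%:E * mu ((fun x => c * x + d)%R @^-1` A) = mu A.
Proof.
move=> c0 mA.
pose nu := mscale (NngNum (normr_ge0 c)) (image c d).
suff : mu A = nu A by [].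
apply: (@lebesgue_measure_unique R nu) => // _ [[a b]] _ <-.
rewrite /nu /mscale /= /pushforward /affine.
have [ba|ab] := leP b a.
  by rewrite !set_itv_ge ?preimage_set0 ?measure0 ?mule0//= bnd_simp -leNgt.
have [cp|cn] : (0 < c \/ c < 0)%R.
  by apply/orP; rewrite -real_neqr_lt ?num_real 1?eq_sym.
- rewrite [X in _ = _ * mu X](_ : _ = `]((a - d) / c)%R, ((b - d) / c)%R]%classic); last first.
    apply/funext => x /=.
    by rewrite !in_itv/= ltr_pdivrMr// ler_pdivlMr// ltrBlDr lerBrDr mulrC.
  rewrite !lebesgue_measure_itv/= !lte_fin ab ltr_pM2r ?invr_gt0// ifT; last lra.
  rewrite gtr0_norm// -!EFinD -EFinM; congr EFin; field; lra.
- rewrite [X in _ = _ * mu X](_ : _ = `[((b - d) / c)%R, ((a - d) / c)%R[%classic); last first.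
    apply/funext => x /=.
    by rewrite !in_itv/= ltr_ndivlMr// ler_ndivrMr// ltrBlDr lerBrDr mulrC andbC.
  rewrite !lebesgue_measure_itv/= !lte_fin ab ltr_nM2r ?invr_lt0// ifT; last lra.
  rewrite ltr0_norm// -!EFinD -EFinM; congr EFin; field; lra.
Qed.

Lemma ge0_integral_affine (f : R -> \bar R) (c d : R) : c != 0%R ->
  measurable_fun setT f -> (forall x, 0 <= f x) ->
  \int[mu]_x f x = `|c|%:E * \int[mu]_x f (c * x + d)%R.
Proof.
move=> c0 mf f0.
have := @ge0_integral_pushforward _ _ _ _ _ _ (measurable_affine c d) mu
  setT f measurableT mf (fun x _ => f0 x).
rewrite preimage_setT => <-.
rewrite -(@ge0_integral_mscale _ _ _ (image c d) setT measurableT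
  (NngNum (normr_ge0 c)) f)//.
apply: eq_measure_integral => A mA _.
exact/esym/lebesgue_measure_affine.
Qed.

End affine_substitution.

Ltac measurable_tac := repeat first
  [ exact: measurable_cst | exact: measurable_id
  | exact: measurable_fst | exact: measurable_snd
  | apply: measurable_funX | apply: measurable_funD | apply: measurable_funM
  | apply: (measurableT_comp measurable_fst)
  | apply: (measurableT_comp measurable_snd) | apply: measurable_fun_pair ].

(** * Shears and rotations in iterated integrals over the plane and space *)

Section iterated_integrals.
Variable R : realType.
Local Notation mu := (@lebesgue_measure R).
Local Open Scope ereal_scope.

Lemma integral2_swap (K : R -> R -> \bar R) :
  measurable_fun setT (fun u : R * R => K u.1 u.2) ->
  (forall x y, 0 <= K x y) ->
  \int[mu]_x \int[mu]_y K x y = \int[mu]_y \int[mu]_x K x y.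
Proof. by move=> mK K0; exact: (@fubini_tonelli _ _ _ _ R mu mu (fun u => K u.1 u.2)). Qed.

Lemma measurable_integral_snd d (T : measurableType d) (K : T -> R -> \bar R) :
  measurable_fun setT (fun u : T * R => K u.1 u.2) ->
  (forall x y, 0 <= K x y) ->
  measurable_fun setT (fun x => \int[mu]_y K x y).
Proof.
move=> mK K0.
exact: (@measurable_fun_fubini_tonelli_F _ _ T _ R mu (fun u => K u.1 u.2)).
Qed.

(** For fixed [x] this is an affine substitution in [y]. Alternated with exchanges of the two
    variables, such shears compose to rotations and scalings. *)
Lemma integral2_shear (K : R -> R -> \bar R) (c e : R) : c != 0%R ->
  measurable_fun setT (fun u : R * R => K u.1 u.2) ->
  (forall x y, 0 <= K x y) ->
  \int[mu]_x \int[mu]_y K x y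
  = `|c|%:E * \int[mu]_x \int[mu]_y K x (c * y + e * x)%R.
Proof.
move=> c0 mK K0; rewrite -ge0_integralZl//; last 2 first.
- apply: (@measurable_integral_snd _ (measurableTypeR R) (fun x y => K x (c * y + e * x)%R)) => //.
  apply: (measurableT_comp mK
    (g := fun u : R * R => (u.1, (c * u.2 + e * u.1)%R))); measurable_tac.
- by move=> x _; exact: integral_ge0.
apply: eq_integral => x _.
rewrite (@ge0_integral_affine _ _ c (e * x))//.
by apply: (measurableT_comp mK (g := fun y : R => (x, y))); measurable_tac.
Qed.

Let integral2_rotation_neq0 (G : R * R -> \bar R) (a b : R) : b != 0%R ->
  measurable_fun setT G -> (forall u, 0 <= G u) ->
  \int[mu]_y \int[mu]_x G (x ^+ 2 + y ^+ 2, a * x + b * y)%R =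
  \int[mu]_y \int[mu]_x
    G (x ^+ 2 + y ^+ 2, Num.sqrt (a ^+ 2 + b ^+ 2) * y)%R.
Proof.
move=> b0 mG G0; set w := Num.sqrt _.
have w2 : (w ^+ 2 = a ^+ 2 + b ^+ 2)%R by rewrite sqr_sqrtr ?addr_ge0 ?sqr_ge0.
have w0 : (w != 0)%R.
  by rewrite -sqrf_eq0 w2 lt0r_neq0// ltr_wpDl ?sqr_ge0// exprn_even_gt0.
have mK (p q : R * R -> R) : measurable_fun setT p -> measurable_fun setT q ->
    measurable_fun setT (fun u => G (p u, q u)).
  by move=> mp mq; apply: (measurableT_comp mG); exact: measurable_fun_pair.
rewrite integral2_swap; [|by apply: mK; measurable_tac|by move=> *; exact: G0].
(* This shear turns the linear form into [w * y]; the next one, in [x], restores the sum of squares.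
   Their composite sends [(x, y)] to [((b x + a y) / w, (b y - a x) / w)], a rotation, and the two
   Jacobians cancel. *)
rewrite (@integral2_shear _ (w / b) (- a / b))//; last 2 first.
- by rewrite mulf_neq0 ?invr_eq0.
- by apply: mK; measurable_tac.
rewrite integral2_swap; [|by apply: mK; measurable_tac|by move=> *; exact: G0].
rewrite (@integral2_shear _ (b / w) (a / w))//; last 2 first.
- by rewrite mulf_neq0 ?invr_eq0.
- by apply: mK; measurable_tac.
rewrite muleA -EFinM -normrM (_ : w / b * (b / w) = 1)%R; last first.
  by field; rewrite ?b0 ?w0.
rewrite normr1 mul1e; apply: eq_integral => y _; apply: eq_integral => x _.
have -> : (a * (b / w * x + a / w * y) +
    b * (w / b * y + - a / b * (b / w * x + a / w * y)) = w * y)%R.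
  by field; rewrite ?b0 ?w0.
suff -> : ((b / w * x + a / w * y) ^+ 2 +
    (w / b * y + - a / b * (b / w * x + a / w * y)) ^+ 2 = x ^+ 2 + y ^+ 2)%R.
  by [].
have -> : (w / b * y + - a / b * (b / w * x + a / w * y) =
    (w ^+ 2 - a ^+ 2) / (w * b) * y - a / w * x)%R by field; rewrite ?b0 ?w0.
have -> : ((w ^+ 2 - a ^+ 2) / (w * b) = b / w)%R.
  by rewrite w2; field; rewrite ?b0 ?w0.
have -> : ((b / w * x + a / w * y) ^+ 2 + (b / w * y - a / w * x) ^+ 2 =
    (a ^+ 2 + b ^+ 2) / w ^+ 2 * (x ^+ 2 + y ^+ 2))%R by field; rewrite ?b0 ?w0.
by rewrite -w2 divff ?mul1r// sqrf_eq0.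
Qed.

Lemma integral2_rotation (G : R * R -> \bar R) (a b : R) :
  measurable_fun setT G -> (forall u, 0 <= G u) ->
  \int[mu]_y \int[mu]_x G (x ^+ 2 + y ^+ 2, a * x + b * y)%R =
  \int[mu]_y \int[mu]_x
    G (x ^+ 2 + y ^+ 2, Num.sqrt (a ^+ 2 + b ^+ 2) * y)%R.
Proof.
move=> mG G0; have [->|b0] := eqVneq b 0%R; last exact: integral2_rotation_neq0.
have [->|a0] := eqVneq a 0%R.
  rewrite expr0n addr0 sqrtr0.
  by apply: eq_integral => y _; apply: eq_integral => x _; rewrite !mul0r addr0.
(* With [b = 0] the two coordinates are exchanged, so that the nonzero coefficient becomes the
   second one. *)
rewrite [(a ^+ 2 + 0 ^+ 2)%R]addrC.
rewrite -integral2_rotation_neq0; [|exact: a0|exact: mG|exact: G0].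
rewrite integral2_swap; last 2 first.
- apply: (measurableT_comp mG (g := fun u : R * R =>
    (u.2 ^+ 2 + u.1 ^+ 2, a * u.2 + 0 * u.1)%R)).
  by measurable_tac.
- by move=> *; exact: G0.
apply: eq_integral => x _; apply: eq_integral => y _.
by rewrite !mul0r addr0 add0r addrC.
Qed.

Definition integral3 (K : R -> R -> R -> \bar R) : \bar R :=
  \int[mu]_z \int[mu]_y \int[mu]_x K x y z.

Definition measurable3 (K : R -> R -> R -> \bar R) :=
  measurable_fun setT (fun u : R * R * R => K u.1.1 u.1.2 u.2).

Lemma measurable3_comp d (T : measurableType d) (K : R -> R -> R -> \bar R)
    (f g h : T -> R) :
  measurable3 K -> measurable_fun setT f -> measurable_fun setT g ->
  measurable_fun setT h -> measurable_fun setT (fun u => K (f u) (g u) (h u)).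
Proof.
move=> mK mf mg mh.
apply: (measurableT_comp mK (g := fun u => (f u, g u, h u))).
by do 2 apply: measurable_fun_pair => //.
Qed.

(** Two Tonelli exchanges bring [x] outermost and leave the plane of [y] and [z] inside, ready for a
    rotation. *)
Lemma integral3_swap (K : R -> R -> R -> \bar R) : measurable3 K ->
  (forall x y z, 0 <= K x y z) ->
  integral3 K = \int[mu]_x \int[mu]_z \int[mu]_y K x y z.
Proof.
move=> mK K0.
transitivity (\int[mu]_z \int[mu]_x \int[mu]_y K x y z).
  apply: eq_integral => z _; apply: integral2_swap => //.
  by apply: measurable3_comp => //; measurable_tac.
apply: integral2_swap => //; last by move=> x y; exact: integral_ge0.
apply: (@measurable_integral_snd _ (R * R)%type
  (fun u y => K u.2 y u.1)) => //.
by apply: measurable3_comp => //; measurable_tac.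
Qed.

Lemma integral3_shift (K : R -> R -> R -> \bar R) (a b c : R) :
  measurable3 K -> (forall x y z, 0 <= K x y z) ->
  integral3 K = integral3 (fun x y z => K (x + a) (y + b) (z + c))%R.
Proof.
have shift (f : R -> \bar R) (t : R) : measurable_fun setT f ->
    (forall x, 0 <= f x) -> \int[mu]_x f x = \int[mu]_x f (x + t)%R.
  move=> mf f0; rewrite (@ge0_integral_affine _ _ 1%R t)// normr1 mul1e.
  by under eq_integral do rewrite mul1r.
move=> mK K0; rewrite /integral3.
transitivity (\int[mu]_z \int[mu]_y \int[mu]_x K x y (z + c)%R).
  apply: shift; last by move=> z; do 2 apply: integral_ge0 => ? _.
  apply: (@measurable_integral_snd _ (measurableTypeR R)
    (fun z y => \int[mu]_x K x y z)); last by move=> *; exact: integral_ge0.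
  apply: (@measurable_integral_snd _ (R * R)%type
    (fun u x => K x u.2 u.1)) => //.
  by apply: measurable3_comp => //; measurable_tac.
apply: eq_integral => z _.
transitivity (\int[mu]_y \int[mu]_x K x (y + b)%R (z + c)%R).
  apply: (shift (fun y => \int[mu]_x K x y (z + c)%R)); last by move=> y; exact: integral_ge0.
  apply: (@measurable_integral_snd _ (measurableTypeR R)
    (fun y x => K x y (z + c)%R)) => //.
  by apply: measurable3_comp => //; measurable_tac.
apply: eq_integral => y _.
apply: (shift (fun x => K x (y + b)%R (z + c)%R)) => //.
by apply: measurable3_comp => //; measurable_tac.
Qed.

(** A rotation of the [x], [y] plane for fixed [z] turns [a * x + b * y] into [w * y]; one of the
    [y], [z] plane for fixed [x] then merges [w * y + c * z] into a multiple of [z]. *)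
Lemma integral3_rotation (G : R * R -> \bar R) (a b c : R) :
  measurable_fun setT G -> (forall u, 0 <= G u) ->
  integral3 (fun x y z =>
    G (x ^+ 2 + y ^+ 2 + z ^+ 2, a * x + b * y + c * z)%R) =
  integral3 (fun x y z => G (x ^+ 2 + y ^+ 2 + z ^+ 2,
    Num.sqrt (a ^+ 2 + b ^+ 2 + c ^+ 2) * z)%R).
Proof.
move=> mG G0; set w := Num.sqrt (a ^+ 2 + b ^+ 2).
have w2 : (w ^+ 2 = a ^+ 2 + b ^+ 2)%R by rewrite sqr_sqrtr ?addr_ge0 ?sqr_ge0.
have mK d (T : measurableType d) (p q : T -> R) :
    measurable_fun setT p -> measurable_fun setT q ->
    measurable_fun setT (fun u => G (p u, q u)).
  by move=> mp mq; apply: (measurableT_comp mG); exact: measurable_fun_pair.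
transitivity (integral3 (fun x y z =>
    G (x ^+ 2 + y ^+ 2 + z ^+ 2, w * y + c * z)%R)).
  apply: eq_integral => z _.
  apply: (@integral2_rotation (fun u => G (u.1 + z ^+ 2, u.2 + c * z)%R)) => //.
  by apply: mK; measurable_tac.
rewrite integral3_swap; [|by apply: mK; measurable_tac|by move=> *; exact: G0].
rewrite [RHS]integral3_swap; last 2 first.
- by apply: mK; measurable_tac.
- by move=> *; exact: G0.
apply: eq_integral => x _; rewrite -w2.
pose Gx (u : R * R) := G (x ^+ 2 + u.1, u.2)%R.
have mGx : measurable_fun setT Gx by apply: mK; measurable_tac.
transitivity (\int[mu]_z \int[mu]_y Gx (y ^+ 2 + z ^+ 2, w * y + c * z)%R).
  by apply: eq_integral => z _; apply: eq_integral => y _; rewrite /Gx addrA.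
rewrite integral2_rotation; [|exact: mGx|by move=> u; exact: G0].
by apply: eq_integral => z _; apply: eq_integral => y _; rewrite /Gx addrA.
Qed.

End iterated_integrals.

Arguments integral3 {R}.
Arguments measurable3 {R}.

(** * Positivity of Gram matrices *)

Section gram.
Local Open Scope ereal_scope.

(** The quadratic form is the integral of the square of [\sum_i u i * f i]. Finiteness of each
    [V i j] makes the products integrable, which allows the exchange of sum and integral for [u] of
    any sign. *)
Lemma gram_integral d (T : measurableType d) (R : realType)
    (m : {measure set T -> \bar R}) (p : nat) (f : 'I_p -> T -> R)
    (V : 'I_p -> 'I_p -> R) :
  (forall i, measurable_fun setT (f i)) -> (forall i t, 0 <= f i t)%R ->
  (forall i j, \int[m]_t (f i t * f j t)%:E = (V i j)%:E) ->
  forall u : 'I_p -> R, (0 <= \sum_i \sum_j u i * u j * V i j)%R.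
Proof.
move=> mf f0 fV u.
have int2 i j : m.-integrable setT (fun t => (f i t * f j t)%:E).
  apply/integrableP; split; first exact/measurable_EFinP/measurable_funM.
  under eq_integral do rewrite gee0_abs ?lee_fin ?mulr_ge0//.
  by rewrite fV ltry.
rewrite -lee_fin pair_bigA /= -sumEFin.
suff <- : \int[m]_t ((\sum_i u i * f i t) ^+ 2)%:E =
    \sum_(k : 'I_p * 'I_p) (u k.1 * u k.2 * V k.1 k.2)%:E.
  by apply: integral_ge0 => t _; rewrite lee_fin sqr_ge0.
transitivity (\int[m]_t \sum_(k : 'I_p * 'I_p)
    (u k.1 * u k.2)%:E * (f k.1 t * f k.2 t)%:E).
  apply: eq_integral => t _; rewrite expr2 big_distrlr/= pair_bigA/= -sumEFin.
  by apply: eq_bigr => k _; rewrite -EFinM mulrACA.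
rewrite integral_sum//; last by move=> k; exact: integrableZl.
by apply: eq_bigr => k _; rewrite integralZl// fV EFinM.
Qed.

End gram.

(** * Indicators of inequalities, the product measure on space, and the area of a disc *)

Definition lt01 {R : realType} (s t : R) : R := if (s < t)%R then 1%R else 0%R.

Section overlap.
Variable R : realType.
Local Notation mu := (@lebesgue_measure R).
Local Open Scope ereal_scope.

Lemma lt01_ge0 (s t : R) : (0 <= lt01 s t)%R.
Proof. by rewrite /lt01; case: ifP. Qed.

Lemma measurable_lt01 d (T : measurableType d) (f g : T -> R) :
  measurable_fun setT f -> measurable_fun setT g ->
  measurable_fun setT (fun u => lt01 (f u) (g u)).
Proof. by move=> mf mg; apply: measurable_fun_ifT => //; exact: measurable_fun_ltr. Qed.

Let mu2_sigma_finite : sigma_finite setT (mu \x mu).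
Proof.
pose I (n : nat) : set R := `[(- n%:R)%R, n%:R%R]%classic.
exists (fun n => I n `*` I n).
  apply/esym; rewrite -subTset => -[x y] _.
  pose m := Num.max `|x|%R `|y|%R; exists (Num.truncn m).+1 => //.
  have := truncnS_gt m; rewrite /m gt_max => /andP[/ltW xn /ltW yn].
  by split; rewrite /I /= in_itv/= -ler_norml.
move=> n; split; first by apply: measurableX; exact: measurable_itv.
rewrite product_measure1E; [|exact: measurable_itv|exact: measurable_itv].
have fin : mu (I n) < +oo by rewrite /I lebesgue_measure_itv/=; case: ifP => _; rewrite ?ltry.
by apply: lte_mul_pinfty; rewrite ?ge0_fin_numE.
Qed.

(** The planar measure is packed as sigma-finite so that Tonelli applies again to its product with a
    third copy of [mu]. *)
Let mu2 : {sigma_finite_measure set (measurableTypeR R * measurableTypeR R)%type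
    -> \bar R} :=
  HB.pack (mu \x mu) (Measure_isSigmaFinite.Build _ _ _ (mu \x mu) mu2_sigma_finite).

(** Rotations act on iterated integrals, whereas [gram_integral] asks for one measure; this is the
    passage between the two. *)
Lemma integral3E (K : R -> R -> R -> \bar R) :
  measurable3 K -> (forall x y z, 0 <= K x y z) ->
  integral3 K = \int[mu2 \x mu]_u K u.1.1 u.1.2 u.2.
Proof.
move=> mK K0.
rewrite (@fubini_tonelli2 _ _ (measurableTypeR R * measurableTypeR R)%type (measurableTypeR R)
  R mu2 mu (fun u => K u.1.1 u.1.2 u.2))//.
apply: eq_integral => z _.
rewrite /fubini_G (@fubini_tonelli2 _ _ _ _ R mu mu (fun u => K u.1 u.2 z))//.
by apply: measurable3_comp => //; measurable_tac.
Qed.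

Lemma gram_integral3 (p : nat) (f : 'I_p -> R -> R -> R -> R)
    (V : 'I_p -> 'I_p -> R) :
  (forall i, measurable_fun setT (fun u : R * R * R => f i u.1.1 u.1.2 u.2)) ->
  (forall i x y z, 0 <= f i x y z)%R ->
  (forall i j, integral3 (fun x y z => (f i x y z * f j x y z)%:E) = (V i j)%:E) ->
  forall u : 'I_p -> R, (0 <= \sum_i \sum_j u i * u j * V i j)%R.
Proof.
move=> mf f0 fV; apply: (@gram_integral _ _ R (mu2 \x mu) p
  (fun i u => f i u.1.1 u.1.2 u.2) V mf (fun _ _ => f0 _ _ _ _)) => i j.
rewrite -fV integral3E//.
- by apply/measurable_EFinP; exact: measurable_funM.
- by move=> x y z; rewrite lee_fin mulr_ge0.
Qed.

(** This is pi. Its value is never computed: being finite and positive is enough. *)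
Definition disc_area : \bar R :=
  \int[mu]_y \int[mu]_x (lt01 (x ^+ 2 + y ^+ 2) 1)%:E.

(** Scaling each coordinate by the square root of [s], by a shear of slope zero, produces the factor
    [s]; for [s <= 0] the disc is empty. *)
Lemma integral_disc (s : R) :
  \int[mu]_y \int[mu]_x (lt01 (x ^+ 2 + y ^+ 2) s)%:E
  = (Num.max 0 s)%:E * disc_area.
Proof.
have [s0|s0] := leP s 0%R.
  rewrite mul0e; apply: integral0_eq => y _; apply: integral0_eq => x _.
  by rewrite /lt01 ifF//; apply/negbTE; rewrite -leNgt (le_trans s0)// addr_ge0 ?sqr_ge0.
pose w := Num.sqrt s.
have w2 : (w ^+ 2 = s)%R by rewrite sqr_sqrtr// ltW.
have w0 : (w != 0)%R by rewrite -sqrf_eq0 w2 gt_eqF.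
have mK d (T : measurableType d) (p q : T -> R) :
    measurable_fun setT p -> measurable_fun setT q ->
    measurable_fun setT (fun u => (lt01 (p u) (q u))%:E).
  by move=> mp mq; apply/measurable_EFinP; exact: measurable_lt01.
have K0 (x y : R) : 0 <= (lt01 x y)%:E by rewrite lee_fin lt01_ge0.
rewrite (@integral2_shear _ _ w 0%R w0);
  [|by apply: mK; measurable_tac|by move=> *; exact: K0].
rewrite integral2_swap; [|by apply: mK; measurable_tac|by move=> *; exact: K0].
rewrite (@integral2_shear _ _ w 0%R w0);
  [|by apply: mK; measurable_tac|by move=> *; exact: K0].
rewrite integral2_swap; [|by apply: mK; measurable_tac|by move=> *; exact: K0].
rewrite muleA -EFinM -normrM -expr2 w2 (gtr0_norm s0); congr (_ * _).
apply: eq_integral => y _; apply: eq_integral => x _; congr (_%:E).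
rewrite !mul0r !addr0 !exprMn -mulrDr w2 /lt01.
by rewrite -[X in (_ < X)%R](mulr1 s) ltr_pM2l.
Qed.

Lemma integral_lt01_sqr (c : R) : (0 <= c)%R ->
  \int[mu]_x (lt01 (x ^+ 2) (c ^+ 2))%:E = (c *+ 2)%:E.
Proof.
move=> c0; transitivity (\int[mu]_x (\1_(`]-c, c[%classic : set R) x)%:E).
  apply: eq_integral => x _; congr (_%:E); rewrite /lt01 indicE.
  rewrite mem_setE in_itv/= -ltr_norml -[(x ^+ 2)%R]real_normK ?num_real//.
  by rewrite ltr_pXn2r ?nnegrE//; case: ifP.
transitivity (mu `](- c)%R, c[%classic); first by rewrite integral_indic ?setIT.
rewrite lebesgue_measure_itv/= lte_fin.
case: ifPn => [_|]; first by rewrite -EFinD opprK mulr2n.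
rewrite -leNgt => cc; have -> : (c = 0)%R by lra.
by rewrite mul0rn.
Qed.

(** The unit disc contains the square of half-side 1/2 and lies in the square of half-side 1, up to
    boundary points. *)
Lemma disc_area_fin : exists2 a : R, (0 < a)%R & disc_area = a%:E.
Proof.
have mK d (T : measurableType d) (p q : T -> R) :
    measurable_fun setT p -> measurable_fun setT q ->
    measurable_fun setT (fun u => (lt01 (p u) (q u))%:E).
  by move=> mp mq; apply/measurable_EFinP; exact: measurable_lt01.
have K0 (x y : R) : 0 <= (lt01 x y)%:E by rewrite lee_fin lt01_ge0.
have sq (c : R) : (0 <= c)%R -> \int[mu]_y \int[mu]_x
    ((lt01 (y ^+ 2) (c ^+ 2))%:E * (lt01 (x ^+ 2) (c ^+ 2))%:E) = ((c *+ 2) ^+ 2)%:E.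
  move=> c0.
  transitivity (\int[mu]_y ((lt01 (y ^+ 2) (c ^+ 2))%:E * (c *+ 2)%:E)).
    apply: eq_integral => y _; rewrite ge0_integralZl ?integral_lt01_sqr//.
    by apply: mK; measurable_tac.
  rewrite ge0_integralZr// ?integral_lt01_sqr// ?lee_fin ?mulrn_wge0//.
  by apply: mK; measurable_tac.
have le2 (f g : R -> R -> \bar R) :
    measurable_fun setT (fun u : R * R => f u.1 u.2) ->
    measurable_fun setT (fun u : R * R => g u.1 u.2) ->
    (forall x y, 0 <= f x y) -> (forall x y, f x y <= g x y) ->
    \int[mu]_y \int[mu]_x f y x <= \int[mu]_y \int[mu]_x g y x.
  move=> mf mg f0 fg; have g0 x y : 0 <= g x y by exact: le_trans (fg x y).
  have sec (h : R -> R -> \bar R) y :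
      measurable_fun setT (fun u : R * R => h u.1 u.2) ->
      measurable_fun setT (h y).
    move=> mh; apply: (measurableT_comp mh (g := fun x : R => (y, x))).
    by measurable_tac.
  apply: ge0_le_integral => //; do ?[by move=> *; exact: integral_ge0
    | exact: (@measurable_integral_snd _ _ (measurableTypeR R))].
  by move=> y _; apply: ge0_le_integral => //; exact: sec.
have lo : ((2^-1 *+ 2) ^+ 2)%:E <= disc_area.
  rewrite -sq//; apply: le2 => //.
  - by apply: emeasurable_funM; apply: mK; measurable_tac.
  - by apply: mK; measurable_tac.
  - by move=> x y; rewrite mule_ge0.
  - move=> y x; rewrite -EFinM lee_fin /lt01.
    by case: ifPn => ?; case: ifPn => ?; case: ifPn => ?; lra.
have hi : disc_area <= ((1 *+ 2) ^+ 2)%:E.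
  rewrite -sq//; apply: le2 => //.
  - by apply: mK; measurable_tac.
  - by apply: emeasurable_funM; apply: mK; measurable_tac.
  - move=> y x; rewrite -EFinM lee_fin /lt01.
    have := sqr_ge0 x; have := sqr_ge0 y.
    by case: ifPn => ?; case: ifPn => ?; case: ifPn => ?; lra.
case: disc_area lo hi => [a| |]//; rewrite !lee_fin => lo _; exists a => //; lra.
Qed.

End overlap.

(* 6 / pi times the volume of the overlap of two balls of diameter T whose
   centres are at distance r. *)
Definition sph {R : realType} (T r : R) : R :=
  if (T <= r)%R then 0%R else (T ^+ 3 - 3 / 2 * r * T ^+ 2 + r ^+ 3 / 2)%R.

(** * The integral of the cross-sections of a lens *)

Section spherical.
Variable R : realType.
Local Notation mu := (@lebesgue_measure R).
Local Open Scope ereal_scope.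

(** For balls of diameter [T] centred at heights 0 and [r] on the [z] axis, the integrand is the
    squared radius of the disc cut out of their intersection at height [z], and 0 where there is
    none. *)
Lemma integral_cap (T r : R) : (0 < T)%R -> (0 <= r)%R ->
  \int[mu]_z (Num.max 0 ((T / 2) ^+ 2 - (`|z - r / 2| + r / 2) ^+ 2))%:E
  = (sph T r / 6)%:E.
Proof.
move=> T0 r0.
pose f (z : R) : R := Num.max 0%R ((T / 2) ^+ 2 - (`|z| + r / 2) ^+ 2)%R.
have f0 z : (0 <= f z)%R by rewrite /f le_max lexx.
have cf : continuous f.
  move=> z; apply: (@continuous_comp _ _ _ (fun z => (T / 2) ^+ 2 - (`|z| + r / 2) ^+ 2)%R
    (fun t : R => Num.max 0%R t)); last first.
    by apply: continuous_max; [exact: cst_continuous|move=> ?; exact: cvg_id].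
  apply: cvgB; first exact: cvg_cst.
  apply: (@continuous_comp _ _ _ (fun z : R => `|z| + r / 2)%R (fun t => t ^+ 2)%R);
    last exact: exprn_continuous.
  by apply: cvgD; [exact: norm_continuous|exact: cvg_cst].
transitivity (\int[mu]_z (f z)%:E).
  (* Recentring at the midpoint of the two centres makes the integrand even. *)
  rewrite (@ge0_integral_affine _ _ 1%R (r / 2)) ?oner_neq0//; last 2 first.
  - apply/measurable_EFinP; apply: measurable_maxr => //.
    apply: measurable_funB => //; apply: measurable_funX; apply: measurable_funD => //.
    by apply: measurableT_comp => //; exact: measurable_funB.
  - by move=> z; rewrite lee_fin le_max lexx.
  rewrite normr1 mul1e; apply: eq_integral => z _.
  by rewrite mul1r addrK.
rewrite /sph; case: ifPn => [Tr|]; last rewrite -ltNge => rT.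
  rewrite mul0r; apply: integral0_eq => z _; rewrite /f; congr EFin.
  apply/max_idPl; rewrite subr_le0 ler_pXn2r ?nnegrE ?addr_ge0 ?divr_ge0 ?(ltW T0)//.
  by have := normr_ge0 z; lra.
rewrite ge0_symfun_integralT//; last by move=> z; rewrite /f /= normrN.
(* Half the height of the lens: [z + r / 2] reaches the radius [T / 2] at [z = b]. *)
pose b := ((T - r) / 2)%R; have b0 : (0 < b)%R by rewrite /b; lra.
pose F (z : R) : R := ((T / 2) ^+ 2 * z - (z + r / 2) ^+ 3 / 3)%R.
pose g (z : R) : R := ((T / 2) ^+ 2 - (z + r / 2) ^+ 2)%R.
have Fg (z : R) : is_derive z 1%R F (g z).
  rewrite /F /g; apply: is_derive_eq; rewrite /GRing.scale /=.
  by field.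
rewrite (_ : \int[mu]_(z in _) _ = \int[mu]_(z in `[0%R, b]) (g z)%:E); last first.
  rewrite [LHS]integral_mkcond [RHS]integral_mkcond.
  apply: eq_integral => z _; rewrite !patchE.
  have -> : (z \in [set x : R | (0 <= x)%R]) = (0 <= z)%R by apply/idP/idP; rewrite inE.
  rewrite mem_setE in_itv/=; have [z0|//] := leP 0%R z.
  rewrite /= /f /g ger0_norm//; case: ifPn => [zb|]; last rewrite -ltNge => bz.
    congr EFin; apply/max_idPr; rewrite subr_ge0 ler_pXn2r ?nnegrE ?addr_ge0 ?divr_ge0 ?(ltW T0)//.
    by move: zb; rewrite /b; lra.
  congr EFin; apply/max_idPl; rewrite subr_le0 ler_pXn2r ?nnegrE ?addr_ge0 ?divr_ge0 ?(ltW T0)//.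
  by move: bz; rewrite /b; lra.
have dF (z : R) : derivable F z 1 by have [] := Fg z.
have cF (z : R) : {for z, continuous F}.
  by apply: differentiable_continuous; apply/derivable1_diffP.
rewrite (@continuous_FTC2 _ g F)//; last 3 first.
- apply: continuous_subspaceT => z; apply: cvgB; first exact: cvg_cst.
  apply: (@continuous_comp _ _ _ (fun z : R => z + r / 2)%R (fun t => t ^+ 2)%R);
    last exact: exprn_continuous.
  by apply: cvgD; [exact: cvg_id|exact: cvg_cst].
- split => //.
  + by apply: cvg_at_right_filter; exact: cF.
  + by apply: cvg_at_left_filter; exact: cF.
- by move=> z _; rewrite derive1E; have [] := Fg z.
by rewrite -EFinB -EFinM; congr EFin; rewrite /F /b; field.
Qed.

End spherical.

(** * Overlap of two balls, and positive definiteness of the spherical kernel *)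

Section ball_overlap.
Variable R : realType.

(* For r >= 0, max (|z|, |z - r|) = |z - r / 2| + r / 2. *)
Lemma lt01_cap (q r w z : R) : 0 <= r ->
  lt01 (w + z ^+ 2) q * lt01 (w + z ^+ 2 + -2 * (r * z) + r ^+ 2) q =
  lt01 w (q - (`|z - r / 2| + r / 2) ^+ 2).
Proof.
move=> r0; have [zr|zr] := leP (r / 2) z.
  have -> : q - (`|z - r / 2| + r / 2) ^+ 2 = q - z ^+ 2.
    by rewrite ger0_norm ?subr_ge0//; ring.
  rewrite /lt01 ltrBrDr.
  case: ifPn => h1; rewrite ?mul0r//; rewrite ifT ?mulr1//.
  have : r * (r / 2) <= r * z by exact: ler_wpM2l.
  lra.
have -> : q - (`|z - r / 2| + r / 2) ^+ 2 = q - (r - z) ^+ 2.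
  by rewrite ltr0_norm ?subr_lt0//; congr (_ - _ ^+ 2); field.
rewrite /lt01 ltrBrDr.
have -> : w + z ^+ 2 + -2 * (r * z) + r ^+ 2 = w + (r - z) ^+ 2 by ring.
case: ifPn => h1; first by rewrite mul1r.
rewrite mul0r ifF//; apply/negbTE; move: h1; rewrite -!leNgt => h1.
apply: (le_trans h1); rewrite lerD2l -subr_ge0.
have -> : (r - z) ^+ 2 - z ^+ 2 = 2 * r * (r / 2 - z) by field.
by rewrite !mulr_ge0// subr_ge0 ltW.
Qed.

Local Notation mu := (@lebesgue_measure R).
Local Open Scope ereal_scope.

Definition ball3 (T a b c x y z : R) : R :=
  lt01 ((x - a) ^+ 2 + (y - b) ^+ 2 + (z - c) ^+ 2)%R ((T / 2) ^+ 2)%R.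

(** A translation puts the first centre at the origin and a rotation puts the second on the [z]
    axis. The horizontal sections of the intersection are then discs, and [integral_cap] sums
    them. *)
Lemma ball3_overlap (T a b c a' b' c' : R) : (0 < T)%R ->
  integral3 (fun x y z => (ball3 T a b c x y z * ball3 T a' b' c' x y z)%:E)
  = (sph T (Num.sqrt ((a - a') ^+ 2 + (b - b') ^+ 2 + (c - c') ^+ 2)) / 6)%:E
    * disc_area R.
Proof.
move=> T0; set r := Num.sqrt _; set q := ((T / 2) ^+ 2)%R.
have r0 : (0 <= r)%R by exact: sqrtr_ge0.
have r2 : (r ^+ 2 = (a' - a) ^+ 2 + (b' - b) ^+ 2 + (c' - c) ^+ 2)%R.
  by rewrite sqr_sqrtr ?addr_ge0 ?sqr_ge0//; ring.
have m1 d (X : measurableType d) (f g : X -> R) : measurable_fun setT f ->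
    measurable_fun setT g ->
    measurable_fun setT (fun u => (lt01 (f u) q * lt01 (g u) q)%:E).
  move=> mf mg; apply/measurable_EFinP; apply: measurable_funM.
    by apply: measurable_lt01 => //; exact: measurable_cst.
  by apply: measurable_lt01 => //; exact: measurable_cst.
have p0 (s t : R) : 0 <= (lt01 s q * lt01 t q)%:E.
  by rewrite lee_fin mulr_ge0// lt01_ge0.
rewrite (integral3_shift _ _ a b c); last 2 first.
- by apply: m1; measurable_tac.
- by move=> x y z; exact: p0.
(* With the first centre at the origin and the second at [d], the squared distance to [d] is
   [|v|^2 - 2 <d, v> + r^2], so both indicators depend only on [|v|^2] and [<d, v>]. *)
pose G (u : R * R) : \bar R :=
  (lt01 u.1 q * lt01 (u.1 + -2 * u.2 + r ^+ 2)%R q)%:E.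
transitivity (integral3 (fun x y z => G (x ^+ 2 + y ^+ 2 + z ^+ 2,
    (a' - a) * x + (b' - b) * y + (c' - c) * z)%R)).
  apply: eq_integral => z _; apply: eq_integral => y _; apply: eq_integral => x _.
  rewrite /G /ball3 /= -/q r2; congr ((lt01 _ _ * lt01 _ _)%:E); ring.
rewrite integral3_rotation; [|by apply: m1; measurable_tac|by move=> u; exact: p0].
rewrite -r2 sqrtr_sqr ger0_norm//.
pose s (z : R) : R := (q - (`|z - r / 2| + r / 2) ^+ 2)%R.
have [A A0 AE] := disc_area_fin R.
transitivity (\int[mu]_z ((Num.max 0 (s z))%:E * disc_area R)).
  apply: eq_integral => z _; rewrite -integral_disc.
  apply: eq_integral => y _; apply: eq_integral => x _.
  rewrite /G /=; congr EFin.
  exact: lt01_cap.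
rewrite AE ge0_integralZr//; last 3 first.
- apply/measurable_EFinP; apply: measurable_maxr => //.
  apply: measurable_funB => //; apply: measurable_funX; apply: measurable_funD => //.
  by apply: measurableT_comp => //; exact: measurable_funB.
- by move=> z _; rewrite lee_fin le_max lexx.
- by rewrite lee_fin ltW.
by rewrite integral_cap.
Qed.

Lemma sph_posdef (T : R) (p : nat) (x : 'I_p -> 'rV[R]_3) (u : 'I_p -> R) :
  (0 < T)%R ->
  (0 <= \sum_i \sum_j u i * u j * sph T (eucl_norm (x i - x j)))%R.
Proof.
move=> T0; have [A A0 AE] := disc_area_fin R.
have c0 : (0 < A / 6)%R by rewrite divr_gt0.
(* The overlap volumes are [A / 6] times [sph]; the form is rescaled by this positive constant to
   become a Gram form. *)
rewrite -(pmulr_rge0 _ c0) mulr_sumr.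
pose V i j := (A / 6 * sph T (eucl_norm (x i - x j)))%R.
have -> : (\sum_i A / 6 * \sum_j u i * u j * sph T (eucl_norm (x i - x j)) =
    \sum_i \sum_j u i * u j * V i j)%R.
  apply: eq_bigr => i _; rewrite mulr_sumr; apply: eq_bigr => j _.
  by rewrite /V mulrCA.
pose f i := ball3 T (x i 0 0)%R (x i 0 1)%R (x i 0 2%:R)%R.
apply: (@gram_integral3 R p f V) u => [i|i y z w|i j].
- by apply: measurable_lt01; measurable_tac.
- by exact: lt01_ge0.
- rewrite ball3_overlap// AE -EFinM /V /eucl_norm !big_ord_recl big_ord0 addr0.
  rewrite !mxE addrA; congr EFin.
  have -> : lift ord0 ord0 = 1%R :> 'I_3 by exact: val_inj.
  have -> : lift ord0 (lift ord0 ord0) = 2%:R%R :> 'I_3 by exact: val_inj.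
  by rewrite mulrAC -mulrA [LHS]mulrC.
Qed.

End ball_overlap.

(** * Binary quadratic forms and the Schur product *)

Section psd.
Variable R : realType.

Definition form (p q s x y : R) : R := p * x ^+ 2 + 2 * q * (x * y) + s * y ^+ 2.

Lemma form_ge0 (p q s : R) : 0 <= p -> 0 <= s -> q ^+ 2 <= p * s ->
  forall x y, 0 <= form p q s x y.
Proof.
move=> p0 s0 qps x y; rewrite /form.
have [p00|pn0] := eqVneq p 0.
  have q0 : q = 0.
    by apply/eqP; rewrite -sqrf_eq0 eq_le sqr_ge0 (le_trans qps)// p00 mul0r.
  by rewrite p00 q0 !(mul0r, mulr0) !add0r mulr_ge0 ?sqr_ge0.
have pp : 0 < p by rewrite lt_def pn0.
rewrite -(pmulr_rge0 _ pp).
have -> : p * (p * x ^+ 2 + 2 * q * (x * y) + s * y ^+ 2) =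
    (p * x + q * y) ^+ 2 + (p * s - q ^+ 2) * y ^+ 2 by ring.
by rewrite addr_ge0 ?sqr_ge0// mulr_ge0 ?sqr_ge0 ?subr_ge0.
Qed.

(** A Cholesky factorisation, once the determinant condition has been recovered from suitable test
    vectors. *)
Lemma form_gram (p q s : R) : (forall x y, 0 <= form p q s x y) ->
  exists a b c d, [/\ p = a ^+ 2 + c ^+ 2, q = a * b + c * d
    & s = b ^+ 2 + d ^+ 2].
Proof.
move=> f0.
have p0 : 0 <= p by have := f0 1 0; rewrite /form; lra.
have s0 : 0 <= s by have := f0 0 1; rewrite /form; lra.
have qps : q ^+ 2 <= p * s.
  have [p00|pn0] := eqVneq p 0; last first.
    have pp : 0 < p by rewrite lt_def pn0.
    have := f0 (- q) p; rewrite /form.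
    have -> : p * (- q) ^+ 2 + 2 * q * (- q * p) + s * p ^+ 2 =
      p * (p * s - q ^+ 2) by ring.
    by rewrite pmulr_rge0// subr_ge0.
  (* With [p = 0] this vector makes the terms in [s] cancel, and the value [- 4 * q ^+ 4] forces
     [q = 0]. *)
  have := f0 (- (s + 1) * q) (2 * q ^+ 2); rewrite /form p00.
  have [->|q0] := eqVneq q 0; first by move=> _; rewrite expr0n mul0r.
  have -> : 0 * (- (s + 1) * q) ^+ 2 + 2 * q * (- (s + 1) * q * (2 * q ^+ 2))
    + s * (2 * q ^+ 2) ^+ 2 = - 4 * (q ^+ 2) ^+ 2 by ring.
  have q2 : 0 < q ^+ 2 by rewrite exprn_even_gt0.
  have := exprn_gt0 2 q2; lra.
have [p00|pn0] := eqVneq p 0.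
  have q0 : q = 0.
    by apply/eqP; rewrite -sqrf_eq0 eq_le sqr_ge0 (le_trans qps)// p00 mul0r.
  exists 0, 0, 0, (Num.sqrt s); split.
  - by rewrite p00; ring.
  - by rewrite q0; ring.
  - by rewrite sqr_sqrtr//; ring.
have pp : 0 < p by rewrite lt_def pn0.
have sp0 : Num.sqrt p != 0 by rewrite gt_eqF ?sqrtr_gt0.
have dd : 0 <= s - q ^+ 2 / p by rewrite subr_ge0 ler_pdivrMr// mulrC.
exists (Num.sqrt p), (q / Num.sqrt p), 0, (Num.sqrt (s - q ^+ 2 / p)); split.
- by rewrite sqr_sqrtr//; ring.
- by field.
- by rewrite expr_div_n !sqr_sqrtr//; ring.
Qed.

Definition psd (n : nat) (K : 'I_n -> 'I_n -> R) : Prop :=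
  forall u : 'I_n -> R, 0 <= \sum_i \sum_j u i * u j * K i j.

(** By [form_gram] the 2x2 matrix is a sum of two rank-one matrices, and each of them contributes
    the form of [K] at a linear combination of [b] and [c]. *)
Lemma psd_schur (n : nat) (K : 'I_n -> 'I_n -> R) (p q s : R) :
  psd n K -> (forall x y, 0 <= form p q s x y) ->
  forall b c : 'I_n -> R, 0 <= \sum_i \sum_j
    K i j * (p * (b i * b j) + q * (b i * c j + c i * b j) + s * (c i * c j)).
Proof.
move=> K0 /form_gram[a1 [a2 [a3 [a4 [-> -> ->]]]]] b c.
have := addr_ge0 (K0 (fun i => a1 * b i + a2 * c i)) (K0 (fun i => a3 * b i + a4 * c i)).
congr (_ <= _); rewrite -big_split; apply: eq_bigr => i _.
by rewrite -big_split; apply: eq_bigr => j _ /=; ring.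
Qed.

End psd.

(** * The triangular kernel on the line *)

Section tri.
Variable R : realType.
Local Notation mu := (@lebesgue_measure R).

Definition tri (T r : R) : R := if T <= r then 0 else T - r.

Lemma tri_psd (T : R) (n : nat) (x : 'I_n -> 'rV[R]_1) : 0 < T ->
  psd R n (fun i j => tri T (eucl_norm (x i - x j))).
Proof.
move=> T0 u; pose A i : set R := `[x i 0 0, x i 0 0 + T[%classic.
apply: (@gram_integral _ (measurableTypeR R) R mu n (fun i => \1_(A i))) => [i|i t|i j].
- by apply: measurable_indic; exact: measurable_itv.
- by rewrite indicE.
rewrite /eucl_norm big_ord_recl big_ord0 addr0 sqrtr_sqr !mxE.
set a := x i 0 0; set b := x j 0 0.
transitivity (mu `[Num.max a b, (Num.min a b + T)[%classic); last first.
  rewrite lebesgue_measure_itv/= lte_fin /tri.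
  have [ab|ab] := leP a b.
    rewrite ler0_norm ?subr_le0// opprB.
    case: ltP => h; case: leP => h' //; try (exfalso; lra).
    by rewrite -EFinD; congr EFin; ring.
  rewrite gtr0_norm ?subr_gt0//.
  case: ltP => h; case: leP => h' //; try (exfalso; lra).
  by rewrite -EFinD; congr EFin; ring.
rewrite -[in RHS](setIT `[_, _[%classic) -integral_indic//.
apply: eq_integral => t _; congr EFin.
rewrite !indicE !mem_setE !in_itv/= -natrM mulnb; congr (_%:R).
have -> : (t < Num.min a b + T) = (t < a + T) && (t < b + T).
  by rewrite -!ltrBlDr lt_min.
rewrite ge_max; congr nat_of_bool.
by rewrite -/a -/b; case: (a <= t); case: (b <= t); case: (t < a + T); case: (t < b + T).
Qed.

End tri.

(** * Differentiability of a glued function, and a tangent inequality *)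

Section monotone_primitive.
Variable R : realType.

(** Continuing [F] by zero to the left of [r] keeps it differentiable because its value and slope
    vanish at [r]. For [r = 0] the junction lies outside [T > 0], so the matching condition is asked
    only for [0 < r]. *)
Lemma is_derive_glue (F d : R -> R) (r : R) : 0 <= r ->
  (forall T : R, 0 < T -> r <= T -> is_derive T 1 F (d T)) ->
  (0 < r -> F r = 0 /\ d r = 0) ->
  forall T : R, 0 < T -> is_derive T 1 (fun T : R => if T <= r then 0 else F T)
    (if T <= r then 0 else d T).
Proof.
move=> r0 Fd F0 T T0; have [Tr|rT|Tr] := ltgtP T r.
- apply: (@near_eq_is_derive _ _ _ (cst (0 : R)) _ _ _ _ _ (is_derive_cst (0 : R) T 1)).
  near=> t; rewrite ifT//; apply: ltW; near: t; exact: lt_nbhsl.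
- apply: (@near_eq_is_derive _ _ _ F); last by apply: Fd => //; exact: ltW.
  near=> t; rewrite ifF//; apply/negbTE; rewrite -ltNge.
  by near: t; exact: lt_nbhsr.
- have [Fr dr] : F r = 0 /\ d r = 0 by apply: F0; rewrite -Tr.
  have [dF DF] : is_derive T 1 F (d T) by apply: Fd => //; rewrite Tr.
  rewrite Tr; rewrite Tr dr in dF DF.
  have FC : (fun h : R => h^-1 *: (F (h *: 1 + r) - F r)) @ 0^' --> (0 : R).
    by move: dF; rewrite /derivable /cvg_to /= -/(derive F r 1) DF.
  (* Each difference quotient of the glued function is either 0 or that of [F], so it is dominated
     by one that tends to 0. *)
  have fC : (fun h : R => h^-1 *: ((if h *: 1 + r <= r then 0 else F (h *: 1 + r))
      - (if r <= r then 0 else F r))) @ 0^' --> (0 : R).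
    apply/cvgr0Pnorm_lt => e e0; move/cvgr0Pnorm_lt : FC => /(_ e e0) FCe.
    near=> h; have Fh : `|h^-1 *: (F (h *: 1 + r) - F r)| < e by near: h.
    apply: le_lt_trans Fh; rewrite lexx Fr.
    by case: ifP => _ //; rewrite subrr scaler0 normr0.
  apply: DeriveDef; first exact: (cvgP _ fC).
  exact: (cvg_lim _ fC).
Unshelve. all: by end_near. Qed.

(** The tangent at [T] to a convex function lies below its value at 0. Since differentiability is
    given only for positive arguments, the second mean value theorem is applied on [[c, T]], with
    [c > 0] coming from the first. *)
Lemma convex_tangent0 (q q1 q2 : R -> R) (T : R) : 0 < T ->
  {within `[0, T], continuous q} ->
  (forall t : R, 0 < t -> is_derive t 1 q (q1 t)) ->
  (forall t : R, 0 < t -> is_derive t 1 q1 (q2 t)) ->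
  (forall t : R, 0 < t -> t <= T -> 0 <= q2 t) ->
  0 <= q 0 - q T + T * q1 T.
Proof.
move=> T0 cq dq dq1 q20.
have [|c] := MVT T0 _ cq (df := q1).
  by move=> t; rewrite in_itv/= => /andP[t0 _]; exact: dq.
rewrite in_itv/= subr0 => /andP[c0 cT] qT.
have cq1 : {within `[c, T], continuous q1}.
  apply: derivable_within_continuous => t; rewrite in_itv/= => /andP[ct _].
  by have [] := dq1 t (lt_le_trans c0 ct).
have [|e] := MVT cT _ cq1 (df := q2).
  by move=> t; rewrite in_itv/= => /andP[ct _]; apply: dq1; exact: lt_trans ct.
rewrite in_itv/= => /andP[ce eT] q1T.
have q2e : 0 <= q2 e by apply: q20; [exact: lt_trans ce|exact: ltW].
have : 0 <= T * (q2 e * (T - c)) by rewrite !mulr_ge0// ?subr_ge0 ltW.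
rewrite -q1T; lra.
Qed.

End monotone_primitive.

(** * Positivity from truncated mixtures of kernels *)

Section core.
Variable R : realType.

(* P r is the primitive of k T r * g T in T that vanishes on T <= r. *)
Definition kernel_primitive (k P : R -> R -> R) (g psi : R -> R) : Prop :=
  [/\ forall r T : R, 0 <= r -> 0 < T -> is_derive T 1 (P r) (k T r * g T),
      forall r, 0 <= r -> P r T @[T --> +oo] --> psi r
    & forall r T, 0 < T -> T <= r -> P r T = 0].

(** The kernel [k] and the distances [r i j] are left abstract so that one argument serves both the
    line and space. *)
Lemma psd_of_primitive (n : nat) (r : 'I_n -> 'I_n -> R) (k : R -> R -> R)
    (P11 P12 P22 : R -> R -> R) (g11 g12 g22 psi11 psi12 psi22 : R -> R) :
  (forall i j, 0 <= r i j) ->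
  (forall T, 0 < T -> psd R n (fun i j => k T (r i j))) ->
  (forall T, 0 < T -> 0 < k T 0) ->
  (forall T x, T <= x -> k T x = 0) ->
  kernel_primitive k P11 g11 psi11 ->
  kernel_primitive k P12 g12 psi12 ->
  kernel_primitive k P22 g22 psi22 ->
  (forall T, 0 < T -> forall x y, 0 <= form R (g11 T) (g12 T) (g22 T) x y) ->
  (forall T, 0 < T -> forall x y,
    0 <= form R (P11 0 T) (P12 0 T) (P22 0 T) x y) ->
  forall b c : 'I_n -> R, 0 <= \sum_i \sum_j
    (psi11 (r i j) * (b i * b j) + psi12 (r i j) * (b i * c j + c i * b j)
     + psi22 (r i j) * (c i * c j)).
Proof.
move=> r0 kpsd k0 kz [d1 l1 z1] [d2 l2 z2] [d3 l3 z3] gpsd Ppsd b c.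
pose h i j (T : R) : R := P11 (r i j) T * (b i * b j)
  + P12 (r i j) T * (b i * c j + c i * b j) + P22 (r i j) T * (c i * c j).
pose G (T : R) : R := \sum_i \sum_j h i j T.
pose dG (T : R) : R := \sum_i \sum_j k T (r i j) * (g11 T * (b i * b j)
  + g12 T * (b i * c j + c i * b j) + g22 T * (c i * c j)).
have GE : G = \sum_(i < n) \sum_(j < n) h i j.
  by apply/funext => T; rewrite fct_sumE; apply: eq_bigr => i _; rewrite fct_sumE.
have GdG (T : R) : 0 < T -> is_derive T 1 G (dG T).
  move=> T0; rewrite GE /dG; apply: is_derive_sum => i; apply: is_derive_sum => j.
  have D1 := d1 _ _ (r0 i j) T0; have D2 := d2 _ _ (r0 i j) T0.
  have D3 := d3 _ _ (r0 i j) T0.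
  rewrite /h; apply: is_derive_eq; rewrite /GRing.scale /=; ring.
have dG0 T : 0 < T -> 0 <= dG T by move=> T0; exact: psd_schur (kpsd T T0) (gpsd T T0) b c.
have Gmono (S T : R) : 0 < S -> S < T -> G S <= G T.
  move=> S0 ST.
  have pos t : t \in `[S, T] -> 0 < t.
    by rewrite in_itv/= => /andP[St _]; exact: lt_le_trans St.
  have [||t tST GE'] := MVT ST (f := G) (df := dG).
  - by move=> t /subset_itv_oo_cc /pos; exact: GdG.
  - apply: derivable_within_continuous => t /pos t0.
    by have [] := GdG t t0.
  - by rewrite -subr_ge0 GE' mulr_ge0 ?dG0 ?subr_ge0 ?ltW// pos// subset_itv_oo_cc.
set S := \sum_i _.
have GS : G T @[T --> +oo] --> S.
  apply: cvg_big => [|i _]; first by move=> ?; exact: add_continuous.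
  apply: cvg_big => [|j _]; first by move=> ?; exact: add_continuous.
  apply: cvgD; first apply: cvgD.
  - by apply: cvgMl; exact: l1.
  - by apply: cvgMl; exact: l2.
  - by apply: cvgMl; exact: l3.
(* The default 1 keeps [T0] positive when no distance is. *)
pose T0 := \big[Num.min/1]_(ij : 'I_n * 'I_n | 0 < r ij.1 ij.2) r ij.1 ij.2.
have T00 : 0 < T0 by apply: lt_bigmin.
have T0r i j : 0 < r i j -> T0 <= r i j.
  by move=> rij; exact: (@bigmin_le_cond _ _ _ _ (i, j) (fun ij => 0 < r ij.1 ij.2)).
suff GT0 : 0 <= G T0.
  apply: (le_trans GT0); rewrite -(cvg_lim _ GS)//.
  apply: limr_ge; first exact: cvgP GS.
  by near=> T; apply: Gmono => //; near: T; apply: nbhs_pinfty_gt; exact: num_real.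
have kT := k0 T0 T00.
(* At scale [T0] the normalised kernel is 1 at coincident points and 0 elsewhere. Its Schur product
   with the matrix of the [P 0 T0] is exactly [G T0]. *)
have Kpsd : psd R n (fun i j => k T0 (r i j) / k T0 0).
  move=> u; have kVpos : 0 <= (k T0 0)^-1 by rewrite invr_ge0 ltW.
  have := mulr_ge0 kVpos (kpsd T0 T00 u); congr (_ <= _).
  rewrite mulr_sumr; apply: eq_bigr => i _; rewrite mulr_sumr.
  by apply: eq_bigr => j _; rewrite mulrC mulrA.
have := psd_schur R n _ _ _ _ Kpsd (Ppsd T0 T00) b c; congr (_ <= _).
apply: eq_bigr => i _; apply: eq_bigr => j _; rewrite /h.
have [<-|rij] := eqVneq 0 (r i j); first by rewrite divff ?gt_eqF// mul1r.
have Tr : T0 <= r i j by apply: T0r; rewrite lt_def eq_sym rij r0.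
by rewrite kz// !mul0r (z1 _ _ T00 Tr) (z2 _ _ T00 Tr) (z3 _ _ T00 Tr) !mul0r !addr0.
Unshelve. all: by end_near. Qed.

End core.

(** * Functions decaying at infinity and their primitives for the two kernels *)

Section regular.
Variable R : realType.

(** The derivatives are separate arguments, so that a linear combination comes with its derivatives
    in explicit form. *)
Definition reg2 (f f1 f2 : R -> R) : Prop :=
  [/\ {within `[0, +oo[, continuous f},
      forall t : R, 0 < t -> is_derive t 1 f (f1 t),
      forall t : R, 0 < t -> is_derive t 1 f1 (f2 t),
      f t @[t --> +oo] --> 0
    & t * f1 t @[t --> +oo] --> 0].

Definition reg3 (f f1 f2 f3 : R -> R) : Prop :=
  [/\ reg2 f f1 f2, forall t : R, 0 < t -> is_derive t 1 f2 (f3 t)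
    & t ^+ 2 * f2 t @[t --> +oo] --> 0].

Lemma reg2_comb (a b : R) (f f1 f2 g g1 g2 : R -> R) :
  reg2 f f1 f2 -> reg2 g g1 g2 ->
  reg2 (fun t => a * f t + b * g t) (fun t => a * f1 t + b * g1 t)
    (fun t => a * f2 t + b * g2 t).
Proof.
move=> [cf df df1 lf lf1] [cg dg dg1 lg lg1]; split.
- by move=> t; apply: cvgD; apply: cvgMr; [exact: cf|exact: cg].
- move=> t t0; have D1 := df _ t0; have D2 := dg _ t0.
  by apply: is_derive_eq; rewrite /GRing.scale /=; ring.
- move=> t t0; have D1 := df1 _ t0; have D2 := dg1 _ t0.
  by apply: is_derive_eq; rewrite /GRing.scale /=; ring.
- have : a * f t + b * g t @[t --> +oo] --> a * 0 + b * 0.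
    by apply: cvgD; apply: cvgMr.
  by rewrite !mulr0 addr0.
- have : a * (t * f1 t) + b * (t * g1 t) @[t --> +oo] --> a * 0 + b * 0.
    by apply: cvgD; apply: cvgMr.
  rewrite !mulr0 addr0; apply: cvg_trans; apply: near_eq_cvg.
  by near=> t; ring.
Unshelve. all: by end_near. Qed.

Lemma reg3_comb (a b : R) (f f1 f2 f3 g g1 g2 g3 : R -> R) :
  reg3 f f1 f2 f3 -> reg3 g g1 g2 g3 ->
  reg3 (fun t => a * f t + b * g t) (fun t => a * f1 t + b * g1 t)
    (fun t => a * f2 t + b * g2 t) (fun t => a * f3 t + b * g3 t).
Proof.
move=> [f2r df2 lf2] [g2r dg2 lg2]; split; first exact: reg2_comb.
- move=> t t0; have D1 := df2 _ t0; have D2 := dg2 _ t0.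
  by apply: is_derive_eq; rewrite /GRing.scale /=; ring.
- have : a * (t ^+ 2 * f2 t) + b * (t ^+ 2 * g2 t) @[t --> +oo] --> a * 0 + b * 0.
    by apply: cvgD; apply: cvgMr.
  rewrite !mulr0 addr0; apply: cvg_trans; apply: near_eq_cvg.
  by near=> t; ring.
Unshelve. all: by end_near. Qed.

Lemma reg2_scale (a : R) (f f1 f2 : R -> R) : reg2 f f1 f2 ->
  reg2 (fun t => a * f t) (fun t => a * f1 t) (fun t => a * f2 t).
Proof.
move=> fr; have := reg2_comb a 0 _ _ _ _ _ _ fr fr.
by congr reg2; apply/funext => t; rewrite mul0r addr0.
Qed.

Lemma reg3_scale (a : R) (f f1 f2 f3 : R -> R) : reg3 f f1 f2 f3 ->
  reg3 (fun t => a * f t) (fun t => a * f1 t) (fun t => a * f2 t)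
    (fun t => a * f3 t).
Proof.
move=> fr; have := reg3_comb a 0 _ _ _ _ _ _ _ _ fr fr.
by congr reg3; apply/funext => t; rewrite mul0r addr0.
Qed.

(** For fixed [x] and [y] the form is a linear combination of three functions; this reduces
    positivity of the matrix of primitives at [r = 0] to a scalar inequality. *)
Lemma reg2_form (x y : R) (f f1 f2 g g1 g2 h h1 h2 : R -> R) :
  reg2 f f1 f2 -> reg2 g g1 g2 -> reg2 h h1 h2 ->
  reg2 (fun t => form R (f t) (g t) (h t) x y)
    (fun t => form R (f1 t) (g1 t) (h1 t) x y)
    (fun t => form R (f2 t) (g2 t) (h2 t) x y).
Proof.
move=> fr gr hr; have := reg2_comb 1 (y ^+ 2) _ _ _ _ _ _
  (reg2_comb (x ^+ 2) (2 * (x * y)) _ _ _ _ _ _ fr gr) hr.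
by congr reg2; apply/funext => t; rewrite /form; ring.
Qed.

Lemma reg3_form (x y : R) (f f1 f2 f3 g g1 g2 g3 h h1 h2 h3 : R -> R) :
  reg3 f f1 f2 f3 -> reg3 g g1 g2 g3 -> reg3 h h1 h2 h3 ->
  reg3 (fun t => form R (f t) (g t) (h t) x y)
    (fun t => form R (f1 t) (g1 t) (h1 t) x y)
    (fun t => form R (f2 t) (g2 t) (h2 t) x y)
    (fun t => form R (f3 t) (g3 t) (h3 t) x y).
Proof.
move=> fr gr hr; have := reg3_comb 1 (y ^+ 2) _ _ _ _ _ _ _ _
  (reg3_comb (x ^+ 2) (2 * (x * y)) _ _ _ _ _ _ _ _ fr gr) hr.
by congr reg3; apply/funext => t; rewrite /form; ring.
Qed.

Lemma cvg_divr_pinfty (h : R -> R) : h t @[t --> +oo] --> 0 ->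
  t^-1 * h t @[t --> +oo] --> 0.
Proof.
move=> h0; rewrite -[X in _ --> X](mulr0 0); apply: cvgM => //.
apply/gtr0_cvgV0; last exact: cvg_id.
by near=> t; near: t; exact: nbhs_pinfty_gt.
Unshelve. all: by end_near. Qed.

Lemma cvg_cancel_pinfty (h : R -> R) : t * h t @[t --> +oo] --> 0 ->
  h t @[t --> +oo] --> 0.
Proof.
move=> /cvg_divr_pinfty; apply: cvg_trans; apply: near_eq_cvg.
near=> t; rewrite mulKf// gt_eqF//; near: t; exact: nbhs_pinfty_gt.
Unshelve. all: by end_near. Qed.

(* Integration by parts gives the closed form of
   int_r^T (t - r) f2 t dt. *)
Definition tri_prim (f f1 : R -> R) (r T : R) : R :=
  if T <= r then 0 else f r - f T + (T - r) * f1 T.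

Lemma tri_primitive (f f1 f2 : R -> R) : reg2 f f1 f2 ->
  kernel_primitive R (tri R) (tri_prim f f1) f2 f.
Proof.
move=> [cf df df1 lf lf1]; split.
- move=> r T r0 T0.
  have -> : tri R T r * f2 T = if T <= r then 0 else (T - r) * f2 T.
    by rewrite /tri; case: ifP => _ //; rewrite mul0r.
  apply: (@is_derive_glue R (fun T => f r - f T + (T - r) * f1 T)
    (fun T => (T - r) * f2 T)) => // [t t0 _|_].
    have D1 := df _ t0; have D2 := df1 _ t0.
    by apply: is_derive_eq; rewrite /GRing.scale /=; ring.
  by rewrite !subrr !mul0r addr0.
- move=> r r0.
  have : f r - f T + (T * f1 T - r * f1 T) @[T --> +oo] --> f r - 0 + (0 - r * 0).
    apply: cvgD; first by apply: cvgB => //; exact: cvg_cst.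
    by apply: cvgB => //; apply: cvgMr; exact: cvg_cancel_pinfty.
  rewrite mulr0 !subr0 addr0; apply: cvg_trans; apply: near_eq_cvg.
  near=> T; rewrite /tri_prim ifF; first by ring.
  apply/negbTE; rewrite -ltNge; near: T; apply: nbhs_pinfty_gt; exact: num_real.
- by move=> r T _ Tr; rewrite /tri_prim Tr.
Unshelve. all: by end_near. Qed.

Lemma tri_prim0_ge0 (f f1 f2 : R -> R) (T : R) : reg2 f f1 f2 -> 0 < T ->
  (forall t, 0 < t -> 0 <= f2 t) -> 0 <= f 0 - f T + T * f1 T.
Proof.
move=> [cf df df1 _ _] T0 f20; apply: (convex_tangent0 R f f1 f2) => //.
- by apply: continuous_subspaceW cf; exact: subset_itvl.
- by move=> t t0 _; exact: f20.
Qed.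

(* Integration by parts gives the closed form of
   int_r^T sph t r (f2 t - t f3 t) / (3 t^2) dt. *)
Definition sph_prim (f f1 f2 : R -> R) (r T : R) : R :=
  if T <= r then 0 else f r - f T + (T - r) * f1 T
    - (T ^+ 3 - 3 / 2 * r * T ^+ 2 + r ^+ 3 / 2) * f2 T * T^-1 / 3.

Lemma sph_primitive (f f1 f2 f3 : R -> R) : reg3 f f1 f2 f3 ->
  kernel_primitive R sph (sph_prim f f1 f2)
    (fun T => (f2 T - T * f3 T) / (3 * T ^+ 2)) f.
Proof.
move=> [[cf df df1 lf lf1] df2 lf2]; split.
- move=> r T r0 T0; set g := fun T => (f2 T - T * f3 T) / (3 * T ^+ 2).
  (* The cubic branch of [sph]; it vanishes at [T = r], as the gluing there requires. *)
  pose h (T : R) := T ^+ 3 - 3 / 2 * r * T ^+ 2 + r ^+ 3 / 2.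
  have -> : sph T r * g T = if T <= r then 0 else h T * g T.
    by rewrite /sph; case: ifP => _ //; rewrite mul0r.
  apply: (@is_derive_glue R (fun T => f r - f T + (T - r) * f1 T
      - h T * f2 T * T^-1 / 3) (fun T => h T * g T)) => // [t t0 _|rpos].
    have D1 := df _ t0; have D2 := df1 _ t0; have D3 := df2 _ t0.
    have tn0 : t != 0 by rewrite gt_eqF.
    have D4 : is_derive t 1 (fun u : R => u^-1) (- t ^- 2).
      have := @is_deriveV R id t 1 1 tn0 (is_derive_id t 1).
      by rewrite /GRing.scale /= mulr1.
    rewrite /h /g; apply: is_derive_eq; rewrite /GRing.scale /=.
    by field.
  have -> : h r = 0 by rewrite /h; field.
  by split; rewrite /= !(mul0r, subrr, addr0).
- move=> r r0.
  (* Expanding the cubic over [3 * T] leaves [f2 T] with the factors [T ^+ 2], [T] and [T^-1]; decay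
     of the first product implies decay of the other two. *)
  have l2 : T * f2 T @[T --> +oo] --> 0.
    apply: cvg_cancel_pinfty; apply: cvg_trans lf2; apply: near_eq_cvg.
    by near=> T; ring.
  have l3 := cvg_divr_pinfty _ (cvg_cancel_pinfty _ l2).
  have : f r - f T + (T * f1 T - r * f1 T)
      - (3^-1 * (T ^+ 2 * f2 T) - r / 2 * (T * f2 T) + r ^+ 3 / 6 * (T^-1 * f2 T))
      @[T --> +oo] --> f r - 0 + (0 - r * 0) - (3^-1 * 0 - r / 2 * 0 + r ^+ 3 / 6 * 0).
    apply: cvgB.
      apply: cvgD; first by apply: cvgB => //; exact: cvg_cst.
      by apply: cvgB => //; apply: cvgMr; exact: cvg_cancel_pinfty.
    by apply: cvgD; [apply: cvgB; apply: cvgMr|apply: cvgMr].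
  rewrite !mulr0 !subr0 !addr0 subr0; apply: cvg_trans; apply: near_eq_cvg.
  near=> T; have T0 : 0 < T by near: T; exact: nbhs_pinfty_gt.
  rewrite /sph_prim ifF; first by field; rewrite gt_eqF.
  apply/negbTE; rewrite -ltNge; near: T; apply: nbhs_pinfty_gt; exact: num_real.
- by move=> r T _ Tr; rewrite /sph_prim Tr.
Unshelve. all: by end_near. Qed.

Lemma sph_prim0_ge0 (f f1 f2 f3 : R -> R) (T : R) : reg3 f f1 f2 f3 -> 0 < T ->
  (forall t, 0 < t -> 0 <= f2 t - t * f3 t) ->
  0 <= f 0 - f T + T * f1 T - T ^+ 2 * f2 T / 3.
Proof.
move=> [[cf df df1 _ _] df2 _] T0 f30; pose u := f2 T / T.
have Tn0 : T != 0 by rewrite gt_eqF.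
(* [f2 t / t] is nonincreasing, so subtracting its value at [T] times [t]
   leaves a function which is convex on [0, T] *)
have u_le (t : R) : 0 < t -> t < T -> u <= f2 t / t.
  move=> t0 tT.
  have Dv (s : R) : 0 < s -> is_derive s 1 (fun s : R => f2 s * s^-1)
      (- (f2 s - s * f3 s) / s ^+ 2).
    move=> s0; have D1 := df2 _ s0; have sn0 : s != 0 by rewrite gt_eqF.
    have D4 : is_derive s 1 (fun u : R => u^-1) (- s ^- 2).
      have := @is_deriveV R id s 1 1 sn0 (is_derive_id s 1).
      by rewrite /GRing.scale /= mulr1.
    by apply: is_derive_eq; rewrite /GRing.scale /=; field.
  have pos s : s \in `[t, T] -> 0 < s.
    by rewrite in_itv/= => /andP[ts _]; exact: lt_le_trans ts.
  have [||s stT] := MVT tT (f := fun s : R => f2 s * s^-1)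
    (df := fun s => - (f2 s - s * f3 s) / s ^+ 2).
  - by move=> s /subset_itv_oo_cc /pos; exact: Dv.
  - by apply: derivable_within_continuous => s /pos s0; have [] := Dv s s0.
  have s0 : 0 < s by apply: pos; exact: subset_itv_oo_cc.
  move=> E; rewrite /u -subr_ge0 -opprB E !mulNr opprK.
  by rewrite !mulr_ge0 ?invr_ge0 ?sqr_ge0 ?f30// subr_ge0 ltW.
(* The cubic has second derivative [- u * t], and its share of the tangent expression is
   [- u * T ^+ 3 / 3], that is [- T ^+ 2 * f2 T / 3]. *)
pose q (t : R) := f t + (- u / 6) * t ^+ 3.
pose q1 (t : R) := f1 t + (- u / 2) * t ^+ 2.
pose q2 (t : R) := f2 t + (- u) * t.
have : 0 <= q 0 - q T + T * q1 T.
  apply: (convex_tangent0 R q q1 q2) => //.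
  - move=> t; apply: cvgD.
      by apply: (continuous_subspaceW _ cf); exact: subset_itvl.
    apply: cvgMr; have : {within `[0, T], continuous (fun t : R => t ^+ 3)}.
      by apply: continuous_subspaceT => ?; exact: exprn_continuous.
    exact.
  - move=> t t0; have D1 := df _ t0.
    by rewrite /q /q1; apply: is_derive_eq; rewrite /GRing.scale /=; field.
  - move=> t t0; have D1 := df1 _ t0.
    by rewrite /q1 /q2; apply: is_derive_eq; rewrite /GRing.scale /=; field.
  - move=> t t0; rewrite le_eqVlt => /predU1P[->|tT].
      by rewrite /q2 /u mulNr divfK// subrr.
    have := u_le t t0 tT; rewrite ler_pdivlMr// /q2; lra.
congr (_ <= _); rewrite /q /q1 /u; field.
exact: Tn0.
Qed.

Lemma tri_prim_form_ge0 (f f1 f2 g g1 g2 h h1 h2 : R -> R) (T : R) :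
  reg2 f f1 f2 -> reg2 g g1 g2 -> reg2 h h1 h2 -> 0 < T ->
  (forall t, 0 < t -> forall x y, 0 <= form R (f2 t) (g2 t) (h2 t) x y) ->
  forall x y, 0 <= form R (tri_prim f f1 0 T) (tri_prim g g1 0 T)
    (tri_prim h h1 0 T) x y.
Proof.
move=> fr gr hr T0 pos x y.
have := tri_prim0_ge0 _ _ _ T (reg2_form x y _ _ _ _ _ _ _ _ _ fr gr hr) T0
  (fun t t0 => pos t t0 x y).
by congr (_ <= _); rewrite /tri_prim [T <= 0]leNgt T0 /= subr0 /form; ring.
Qed.

Lemma sph_prim_form_ge0 (f f1 f2 f3 g g1 g2 g3 h h1 h2 h3 : R -> R) (T : R) :
  reg3 f f1 f2 f3 -> reg3 g g1 g2 g3 -> reg3 h h1 h2 h3 -> 0 < T ->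
  (forall t, 0 < t -> forall x y,
    0 <= form R (f2 t - t * f3 t) (g2 t - t * g3 t) (h2 t - t * h3 t) x y) ->
  forall x y, 0 <= form R (sph_prim f f1 f2 0 T) (sph_prim g g1 g2 0 T)
    (sph_prim h h1 h2 0 T) x y.
Proof.
move=> fr gr hr T0 pos x y.
have Tn0 : T != 0 by rewrite gt_eqF.
have primE (F F1 F2 : R -> R) :
    sph_prim F F1 F2 0 T = F 0 - F T + T * F1 T - T ^+ 2 * F2 T / 3.
  by rewrite /sph_prim leNgt T0 /=; field.
have := sph_prim0_ge0 _ _ _ _ T (reg3_form x y _ _ _ _ _ _ _ _ _ _ _ _ fr gr hr) T0.
rewrite !primE => main; suff : 0 <= form R (f 0) (g 0) (h 0) x y
    - form R (f T) (g T) (h T) x y + T * form R (f1 T) (g1 T) (h1 T) x y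
    - T ^+ 2 * form R (f2 T) (g2 T) (h2 T) x y / 3.
  by congr (_ <= _); rewrite /form; ring.
apply: main => t t0; have := pos t t0 x y.
by congr (_ <= _); rewrite /form; ring.
Qed.

Lemma form_divr (p q s c x y : R) :
  form R (p / c) (q / c) (s / c) x y = form R p q s x y / c.
Proof. by rewrite /form; ring. Qed.

End regular.

(** * From the abstract positivity result to matrix covariances *)

Section covariance.
Variable R : realType.

(** Moving [s1] and [s2] into the vectors and [rho] onto [psi12] gives the shape of the sum in
    [psd_of_primitive]. *)
Lemma covCE (s1 s2 rho r : R) (psi11 psi12 psi22 : R -> R) (a b : 'rV[R]_2) :
  (a *m covC s1 s2 rho psi11 psi12 psi22 r *m b^T) 0 0 =
  psi11 r * (s1 * a 0 0 * (s1 * b 0 0)) + rho * psi12 r *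
    (s1 * a 0 0 * (s2 * b 0 1) + s2 * a 0 1 * (s1 * b 0 0))
  + psi22 r * (s2 * a 0 1 * (s2 * b 0 1)).
Proof.
rewrite !mxE !big_ord_recl big_ord0 !mxE !big_ord_recl !big_ord0 !mxE /=.
have -> : lift ord0 ord0 = 1 :> 'I_2 by exact: val_inj.
rewrite (_ : ord0 = 0)//; ring.
Qed.

Lemma eucl_norm_ge0 (n : nat) (v : 'rV[R]_n) : 0 <= eucl_norm v.
Proof. exact: sqrtr_ge0. Qed.

Lemma pos_def_of_primitive (n : nat) (s1 s2 rho : R) (psi11 psi12 psi22 : R -> R)
    (k P11 P12 P22 : R -> R -> R) (g11 g12 g22 : R -> R) :
  (forall T m (x : 'I_m -> 'rV[R]_n), 0 < T ->
    psd R m (fun i j => k T (eucl_norm (x i - x j)))) ->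
  (forall T, 0 < T -> 0 < k T 0) ->
  (forall T x, T <= x -> k T x = 0) ->
  kernel_primitive R k P11 g11 psi11 ->
  kernel_primitive R k P12 g12 (fun r => rho * psi12 r) ->
  kernel_primitive R k P22 g22 psi22 ->
  (forall T, 0 < T -> forall x y, 0 <= form R (g11 T) (g12 T) (g22 T) x y) ->
  (forall T, 0 < T -> forall x y,
    0 <= form R (P11 0 T) (P12 0 T) (P22 0 T) x y) ->
  pos_def_in n (covC s1 s2 rho psi11 psi12 psi22).
Proof.
move=> kpsd k0 kz K11 K12 K22 g0 P0 m x a.
have := @psd_of_primitive R m (fun i j => eucl_norm (x i - x j)) k _ _ _ _ _ _
  _ _ _ _ _ k0 kz K11 K12 K22 g0 P0 (fun i => s1 * a i 0 0) (fun i => s2 * a i 0 1).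
under [X in _ -> 0 <= X]eq_bigr do under eq_bigr do rewrite covCE.
by apply => [i j|T T0]; [exact: eucl_norm_ge0|exact: kpsd].
Qed.

Lemma Ck_pos_is_derive (k m : nat) (f : R -> R) (t : R) : Ck_pos k f ->
  (m < k)%N -> 0 < t -> is_derive t 1 (derive1n m f) (derive1n m.+1 f t).
Proof.
move=> [df _] mk t0; apply: DeriveDef; first exact: (df m t mk t0).
by rewrite derive1nS derive1E.
Qed.

Lemma reg2_Ck (n : nat) (f : R -> R) : corr_fun_in n f -> Ck_pos 2 f ->
  f r @[r --> +oo] --> 0 -> r * derive1n 1 f r @[r --> +oo] --> 0 ->
  reg2 R f (derive1n 1 f) (derive1n 2 f).
Proof.
move=> [cf _] Cf f0 f1; split; [exact: cf| | |exact: f0|exact: f1].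
- by move=> t t0; exact: (Ck_pos_is_derive 2 0 f t Cf isT t0).
- by move=> t t0; exact: (Ck_pos_is_derive 2 1 f t Cf isT t0).
Qed.

Lemma reg3_Ck (n : nat) (f : R -> R) : corr_fun_in n f -> Ck_pos 3 f ->
  f r @[r --> +oo] --> 0 -> r * derive1n 1 f r @[r --> +oo] --> 0 ->
  r ^+ 2 * derive1n 2 f r @[r --> +oo] --> 0 ->
  reg3 R f (derive1n 1 f) (derive1n 2 f) (derive1n 3 f).
Proof.
move=> [cf _] Cf f0 f1 f2; split; [| |exact: f2]; last first.
  by move=> t t0; exact: (Ck_pos_is_derive 3 2 f t Cf isT t0).
split; [exact: cf| | |exact: f0|exact: f1].
- by move=> t t0; exact: (Ck_pos_is_derive 3 0 f t Cf isT t0).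
- by move=> t t0; exact: (Ck_pos_is_derive 3 1 f t Cf isT t0).
Qed.

(** Clearing the denominator gives the determinant condition. Where [q] vanishes the ratio gives no
    bound, but the form is then diagonal with nonnegative entries. *)
Lemma ratio_le_form_ge0 (rho p q s : R) : 0 <= p -> 0 <= s ->
  (q != 0 -> rho ^+ 2 <= p * s / q ^+ 2) ->
  forall x y, 0 <= form R p (rho * q) s x y.
Proof.
move=> p0 s0 h; apply: form_ge0 => //; have [->|q0] := eqVneq q 0.
  by rewrite mulr0 expr0n mulr_ge0.
by rewrite exprMn -ler_pdivlMr ?exprn_even_gt0// h.
Qed.

End covariance.

(** The bound by an infimum is stated pointwise over the admissible [r], which agrees with an
    infimum equal to plus infinity when there are none. Correlation functions are taken in the
    dimension of the conclusion. *)
Theorem theoremB2 (R : realType) (s1 s2 rho : R) (psi11 psi12 psi22 : R -> R) :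
  0 < s1 -> 0 < s2 ->
  (* (a) *)
  ((forall f, f = psi11 \/ f = psi12 \/ f = psi22 ->
      [/\ corr_fun_in 1 f, Ck_pos 2 f,
          f r @[r --> +oo] --> 0,
          r * derive1n 1 f r @[r --> +oo] --> 0
        & integrable_pos (fun r => r * derive1n 2 f r)]) ->
   (forall r, 0 < r -> 0 <= derive1n 2 psi11 r /\ 0 <= derive1n 2 psi22 r) ->
   (forall r, 0 < r -> derive1n 2 psi12 r != 0 ->
      rho ^+ 2 <= derive1n 2 psi11 r * derive1n 2 psi22 r
                  / (derive1n 2 psi12 r) ^+ 2) ->
   pos_def_in 1 (covC s1 s2 rho psi11 psi12 psi22))
  /\
  (* (b) *)
  ((forall f, f = psi11 \/ f = psi12 \/ f = psi22 ->
      [/\ corr_fun_in 3 f /\ Ck_pos 3 f,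
          f r @[r --> +oo] --> 0,
          r * derive1n 1 f r @[r --> +oo] --> 0,
          r ^+ 2 * derive1n 2 f r @[r --> +oo] --> 0
        & integrable_pos (fun r => r * derive1n 2 f r - r ^+ 2 * derive1n 3 f r)]) ->
   (forall r, 0 < r ->
      0 <= derive1n 2 psi11 r - r * derive1n 3 psi11 r /\
      0 <= derive1n 2 psi22 r - r * derive1n 3 psi22 r) ->
   (forall r, 0 < r -> derive1n 2 psi12 r - r * derive1n 3 psi12 r != 0 ->
      rho ^+ 2 <= (derive1n 2 psi11 r - r * derive1n 3 psi11 r)
                  * (derive1n 2 psi22 r - r * derive1n 3 psi22 r)
                  / (derive1n 2 psi12 r - r * derive1n 3 psi12 r) ^+ 2) ->
   pos_def_in 3 (covC s1 s2 rho psi11 psi12 psi22)).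
Proof.
move=> s10 s20; split=> [H g0 gi|H g0 gi].
- have reg f : f = psi11 \/ f = psi12 \/ f = psi22 ->
      reg2 R f (derive1n 1 f) (derive1n 2 f).
    by move=> /H[cf Cf f0 f1 _]; exact: (reg2_Ck R 1 f cf Cf f0 f1).
  have r11 := reg _ (or_introl erefl).
  have r12 := reg2_scale R rho _ _ _ (reg _ (or_intror (or_introl erefl))).
  have r22 := reg _ (or_intror (or_intror erefl)).
  have form0 t : 0 < t -> forall x y, 0 <= form R (derive1n 2 psi11 t)
      (rho * derive1n 2 psi12 t) (derive1n 2 psi22 t) x y.
    move=> t0; have [g11 g22] := g0 t t0.
    by apply: ratio_le_form_ge0 => //; exact: gi.
  apply: (@pos_def_of_primitive R 1 s1 s2 rho psi11 psi12 psi22 (tri R)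
    _ _ _ _ _ _ _ _ _ (tri_primitive R _ _ _ r11) (tri_primitive R _ _ _ r12)
    (tri_primitive R _ _ _ r22) form0).
  + by move=> T m x T0; exact: tri_psd.
  + by move=> T T0; rewrite /tri leNgt T0 /= subr0.
  + by move=> T x Tx; rewrite /tri Tx.
  + by move=> T T0; exact: (tri_prim_form_ge0 R _ _ _ _ _ _ _ _ _ T r11 r12 r22 T0 form0).
- have reg f : f = psi11 \/ f = psi12 \/ f = psi22 ->
      reg3 R f (derive1n 1 f) (derive1n 2 f) (derive1n 3 f).
    by move=> /H[[cf Cf] f0 f1 f2 _]; exact: (reg3_Ck R 3 f cf Cf f0 f1 f2).
  have r11 := reg _ (or_introl erefl).
  have r12 := reg3_scale R rho _ _ _ _ (reg _ (or_intror (or_introl erefl))).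
  have r22 := reg _ (or_intror (or_intror erefl)).
  have form0 t : 0 < t -> forall x y,
      0 <= form R (derive1n 2 psi11 t - t * derive1n 3 psi11 t)
        (rho * derive1n 2 psi12 t - t * (rho * derive1n 3 psi12 t))
        (derive1n 2 psi22 t - t * derive1n 3 psi22 t) x y.
    move=> t0; have [g11 g22] := g0 t t0.
    rewrite [t * (rho * _)]mulrCA -mulrBr.
    by apply: ratio_le_form_ge0 => //; exact: gi.
  apply: (@pos_def_of_primitive R 3 s1 s2 rho psi11 psi12 psi22 sph
    _ _ _ _ _ _ _ _ _ (sph_primitive R _ _ _ _ r11) (sph_primitive R _ _ _ _ r12)
    (sph_primitive R _ _ _ _ r22)).
  + by move=> T m x T0 u; exact: sph_posdef.
  + move=> T T0; rewrite /sph leNgt T0 /= mulr0 mul0r subr0 expr0n mul0r addr0.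
    exact: exprn_gt0.
  + by move=> T x Tx; rewrite /sph Tx.
  (* In space the mixing densities carry the common factor [1 / (3 * T ^+ 2)], which comes out of
     the form by linearity. *)
  + move=> T T0 x y; rewrite form_divr; apply: divr_ge0; first exact: form0.
    by apply: mulr_ge0 => //; exact: sqr_ge0.
  + by move=> T T0; exact: (sph_prim_form_ge0 R _ _ _ _ _ _ _ _ _ _ _ _ T r11 r12 r22 T0 form0).
Qed.
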